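(* Let $q$ be an odd prime power, $p=\operatorname{char}\mathbb F_q$, $Q(x)=x_1^2+\cdots+x_d^2$ on $\mathbb F_q^d$, and $d\ge2$ with $p\mid d+2$. Suppose that $P_0,\ldots,P_{d+1}\in\mathbb F_q^d$ are equilateral with nonzero common squared distance $\Delta$, i.e. $Q(P_i-P_j)=\Delta\in\mathbb F_q^*$ for all $i\neq j$, and put $$X=\left\{\frac{P_i+P_j}{2}:0\le i<j\le d+1\right\}.$$ Then $X$ is a two-distance set of size $\binom{d+2}{2}$, with squared distances $\Delta/4$ and $\Delta/2$. If $H_X$ is the affine coordinate matrix of $X$ and $\widehat H_X$ is obtained from $H_X$ by adjoining the row $(Q(x))_{x\in X}$, then $$\operatorname{rank}\widehat H_X-\operatorname{rank}(H_X\widehat H_X^T)=1.$$ Consequently, the general bound $|S|\le\binom{d+2}{2}-1+\operatorname{rank}\widehat H_S-\operatorname{rank}(H_S\widehat H_S^T)$, valid for two-distance sets $S\subset\mathbb F_q^d$ with two distinct nonzero squared distances, gives for $S=X$ the sharp bound $|X|\le\binom{d+2}{2}$.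
   Context: A set $S\subseteq\mathbb F_q^d$ is a two-distance set if $Q(x-y)$, over distinct $x,y\in S$, takes exactly two values, called its squared distances. For a finite set $S\subset\mathbb F_q^d$, the affine coordinate matrix $H_S$ is the $(d+1)\times|S|$ matrix over $\mathbb F_q$ whose columns are indexed by the points of $S$, the column of $x$ being $(1,x_1,\ldots,x_d)^T$; $\widehat H_S$ is the $(d+2)\times|S|$ matrix obtained by adjoining the row $(Q(x))_{x\in S}$. Ranks are over $\mathbb F_q$. *)

(* Defs.v *)
From HB Require Import structures.
From mathcomp Require Import all_boot all_order all_algebra.

Set Implicit Arguments.
Unset Strict Implicit.
Unset Printing Implicit Defensive.

Import GRing.Theory.
Local Open Scope ring_scope.

Definition Q (F : finFieldType) (d : nat) (x : 'rV[F]_d) : F :=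
  \sum_(i < d) x 0 i ^+ 2.

Definition sq_distances (F : finFieldType) (d : nat) (S : {set 'rV[F]_d}) :
    {set F} :=
  [set Q (x - y) | x in S, y in S & x != y].

Definition two_distance_set (F : finFieldType) (d : nat)
    (S : {set 'rV[F]_d}) : Prop :=
  #|sq_distances S| = 2%N.

(* The columns follow the enumeration of S: column k is the point
   [enum_val k]; row 0 is the row of ones. *)
Definition affine_mx (F : finFieldType) (d : nat) (S : {set 'rV[F]_d}) :
    'M[F]_(1 + d, #|S|) :=
  col_mx (const_mx 1) (\matrix_(i < d, k < #|S|) (enum_val k : 'rV[F]_d) 0 i).

Definition affine_hat_mx (F : finFieldType) (d : nat) (S : {set 'rV[F]_d}) :
    'M[F]_(1 + d + 1, #|S|) :=
  col_mx (affine_mx S) (\row_(k < #|S|) Q (enum_val k)).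

Definition midpoints (F : finFieldType) (d n : nat) (P : 'I_n -> 'rV[F]_d) :
    {set 'rV[F]_d} :=
  [set 2%:R^-1 *: (P i + P j) | i in 'I_n, j in 'I_n & (i < j)%N].

(* Main.v *)
(* The bound.  Let L and K be the kernels of H_S and of its hatted version, and
   let a, b be the squared distances.  The matrix with entries
   (Q (x - y) - a) (Q (x - y) - b) is a b times the identity.  Expanding it as a
   polynomial in x and y, every term is killed by pairing L with K, except for
   4 (x . y)^2.  On K the combinations of the tensors y y^T have trace zero, so this
   term has rank at most 'C(d + 1, 2) - 1.  On the other hand, the pairing of L and K has
   rank |S| - rank hat H_S - rank H_S + rank (H_S hat H_S^T) by rank-nullity.

   The example.  Since d + 2 = 0 in F, the vertices P_i satisfy exactly one
   affine dependency, the one with all coefficients equal; in particular they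
   affinely span.  For an affine function l, this gives
   \sum_(x in X) l(x) Q (x - P_j) = (Delta / 2) l(P_j), so H_X hat H_X^T has
   full rank d + 1, and the rank defect is at most 1.  It is at least 1 by the
   bound, as |X| = 'C(d + 2, 2). *)

Require Import Defs.
From HB Require Import structures.
From mathcomp Require Import all_boot all_order all_algebra.
From mathcomp Require Import fingroup cyclic ring zify.

Set Implicit Arguments.
Unset Strict Implicit.
Unset Printing Implicit Defensive.

Import GRing.Theory.
Local Open Scope ring_scope.

(** * Rank inequalities and sums over pairs of indices *)

Lemma mxrank_sum_le (F : fieldType) (I : Type) (r : seq I) (P : pred I) m n
    (A : I -> 'M[F]_(m, n)) (b : I -> nat) :
  (forall i, P i -> \rank (A i) <= b i)%N ->
  (\rank (\sum_(i <- r | P i) A i)%R <= \sum_(i <- r | P i) b i)%N.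
Proof.
move=> Ab; elim/big_ind2: _ => [|A1 b1 A2 b2 h1 h2|//].
  by rewrite mxrank0.
by apply: leq_trans (mxrank_add _ _) (leq_add h1 h2).
Qed.

Lemma rank_outer_le1 (F : fieldType) m n (f : 'I_m -> F) (g : 'I_n -> F) :
  (\rank (\matrix_(i, j) (f i * g j))%R <= 1)%N.
Proof.
have -> : \matrix_(i, j) (f i * g j) = (\col_i f i) *m (\row_j g j).
  by apply/matrixP => i j; rewrite !mxE big_ord1 !mxE.
by apply: leq_trans (mxrankM_maxl _ _) (rank_leq_col _).
Qed.

(** The row space of [A] is the annihilator of its kernel. So the pairing of the kernels and the
    product [A *m B^T] lose rank through the same space, the rows of [A] lying in [kermx B^T]; it
    cancels between the two rank-nullity identities. *)
Lemma rank_ker_pairing (F : fieldType) m1 m2 n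
    (A : 'M[F]_(m1, n)) (B : 'M[F]_(m2, n)) :
  (\rank (kermx B^T *m (kermx A^T)^T) + \rank A + \rank B =
   n + \rank (A *m B^T))%N.
Proof.
have eqA : (A :=: kermx (kermx A^T)^T)%MS.
  have sub : (A <= kermx (kermx A^T)^T)%MS.
    apply/sub_kermxP; apply: (can_inj trmxK).
    by rewrite trmx_mul trmxK mulmx_ker trmx0.
  apply/eqmxP; rewrite -(mxrank_leqif_eq sub).
  by rewrite mxrank_ker !mxrank_tr mxrank_ker mxrank_tr subKn ?rank_leq_col.
have := mxrank_mul_ker (kermx B^T) (kermx A^T)^T.
have := mxrank_mul_ker A B^T.
rewrite capmxC -(cap_eqmx (eqmx_refl _) eqA) mxrank_ker mxrank_tr.
by have /subnK := rank_leq_col B; lia.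
Qed.

Lemma sum_offdiag (V : nmodType) n (f : 'I_n -> 'I_n -> V) :
  \sum_i \sum_(j | j != i) f i j =
  \sum_(i < n) \sum_(j < n | (j < i)%N) (f i j + f j i).
Proof.
under [RHS]eq_bigr do rewrite big_split.
rewrite big_split /=.
rewrite [X in _ + X](exchange_big_dep xpredT) //= -big_split /=.
apply: eq_bigr => i _; rewrite (bigID (fun j : 'I_n => (j < i)%N)) /=.
by congr (_ + _); apply: eq_bigl => j; rewrite -val_eqE /=; lia.
Qed.

Lemma sqr_sum (R : comPzRingType) n (z : 'I_n -> R) :
  (\sum_i z i) ^+ 2 =
  \sum_i z i ^+ 2 + \sum_(i < n) \sum_(j < n | (j < i)%N) (z i * z j) *+ 2.
Proof.
have -> : \sum_(i < n) \sum_(j < n | (j < i)%N) (z i * z j) *+ 2 =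
          \sum_i \sum_(j | j != i) z i * z j.
  rewrite sum_offdiag; apply: eq_bigr => i _; apply: eq_bigr => j _.
  by rewrite mulr2n [z j * _]mulrC.
rewrite expr2 mulr_suml -big_split /=; apply: eq_bigr => i _.
by rewrite mulr_sumr (bigD1 i) // expr2.
Qed.

(** * The rank bound for two-distance sets *)

Section Bound.

Variable F : finFieldType.

Definition dot d (x y : 'rV[F]_d) : F := \sum_i x 0 i * y 0 i.

Lemma Q_sub d (x y : 'rV[F]_d) : Q (x - y) = Q x + Q y - dot x y *+ 2.
Proof.
rewrite /Q /dot -sumrMnl -big_split -sumrB /=; apply: eq_bigr => i _.
by rewrite !mxE; ring.
Qed.

(* Trading [y 0 0 ^+ 2] for [Q y], which vanishes on the kernel of
   [affine_hat_mx], saves one product: this is the [- 1] of the bound. *)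
Lemma dot_sqr d (x y : 'rV[F]_d.+1) :
  dot x y ^+ 2 =
  x 0 0 ^+ 2 * Q y +
  (\sum_(i < d) (x 0 (lift 0 i) ^+ 2 - x 0 0 ^+ 2) * y 0 (lift 0 i) ^+ 2 +
   \sum_(i < d.+1) \sum_(j < d.+1 | (j < i)%N)
      (x 0 i * x 0 j *+ 2) * (y 0 i * y 0 j)).
Proof.
rewrite /dot sqr_sum addrA; congr (_ + _).
  rewrite /Q big_ord_recl [in RHS]big_ord_recl mulrDr -addrA; congr (_ + _).
    by rewrite exprMn.
  rewrite mulr_sumr -big_split; apply: eq_bigr => i _ /=; ring.
by apply: eq_bigr => i _; apply: eq_bigr => j _; ring.
Qed.

Lemma card_ord_lt n (i : 'I_n) : (\sum_(j < n | (j < i)%N) 1 = i)%N.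
Proof.
rewrite -(big_mkord (fun j => (j < i)%N) (fun=> 1%N)).
rewrite -(big_nat_widen 0 i n xpredT) ?(ltnW (ltn_ord i)) //.
by rewrite sum_nat_const_nat; lia.
Qed.

Definition quad_mx d n (s : 'I_n -> 'rV[F]_d.+1) : 'M[F]_n :=
  \sum_(i < d) \matrix_(k, l)
     ((s k 0 (lift 0 i) ^+ 2 - s k 0 0 ^+ 2) * s l 0 (lift 0 i) ^+ 2) +
  \sum_(i < d.+1) \sum_(j < d.+1 | (j < i)%N) \matrix_(k, l)
     ((s k 0 i * s k 0 j *+ 2) * (s l 0 i * s l 0 j)).

(** Every summand is an outer product, so it suffices to count: [d] squares and one product for each
    pair [j < i]. *)
Lemma rank_quad_mx d n (s : 'I_n -> 'rV[F]_d.+1) :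
  (\rank (quad_mx s) <= d + 'C(d.+1, 2))%N.
Proof.
apply: leq_trans (mxrank_add _ _) (leq_add _ _).
  rewrite -[X in (_ <= X)%N]card_ord -sum1_card.
  by apply: mxrank_sum_le => i _; apply: rank_outer_le1.
rewrite -bin2_sum big_mkord.
under [X in (_ <= X)%N]eq_bigr => i _ do rewrite -card_ord_lt.
apply: mxrank_sum_le => i _; apply: mxrank_sum_le => j _.
exact: rank_outer_le1.
Qed.

Lemma quad_mxE d n (s : 'I_n -> 'rV[F]_d.+1) k l :
  quad_mx s k l = dot (s k) (s l) ^+ 2 - s k 0 0 ^+ 2 * Q (s l).
Proof.
rewrite dot_sqr addrC addKr mxE !summxE; congr (_ + _).
  by apply: eq_bigr => i _; rewrite !mxE.
apply: eq_bigr => i _; rewrite summxE.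
by apply: eq_bigr => j _; rewrite !mxE.
Qed.

Lemma affine_decomposition d (S : {set 'rV[F]_d.+1}) (a b : F) :
  exists U V,
    \matrix_(k, l) ((Q (enum_val k - enum_val l) - a) *
                    (Q (enum_val k - enum_val l) - b)) =
    (affine_mx S)^T *m U + V *m affine_hat_mx S +
    4%:R *: quad_mx (fun k : 'I_#|S| => enum_val k).
Proof.
pose s (k : 'I_#|S|) : 'rV[F]_d.+1 := enum_val k.
(* With [x = s k] and [y = s l], [U] collects the terms [Q y ^+ 2] and [- 4 Q y (x . y)], affine in
   [x]. [V] collects the other terms, affine in [y] and [Q y]; its [4 x_0^2] is the part of
   [4 (x . y)^2] split off by [dot_sqr]. *)
exists (col_mx (\row_l (Q (s l) ^+ 2))
               (\matrix_(i, l) (- 4%:R * Q (s l) * s l 0 i))).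
exists (row_mx (row_mx (\col_k (Q (s k) ^+ 2 - (a + b) * Q (s k) + a * b))
   (\matrix_(k, i) ((- 4%:R * Q (s k) + 2%:R * (a + b)) * s k 0 i)))
   (\col_k (2%:R * Q (s k) - (a + b) + 4%:R * s k 0 0 ^+ 2))).
rewrite /affine_hat_mx /affine_mx tr_col_mx !mul_row_col.
have := quad_mxE s; rewrite -/s; move: (quad_mx s) => W WE.
apply/matrixP => k l; rewrite !mxE !big_ord1 !mxE -/(s k) -/(s l).
have dotZ c : \sum_i s k 0 i * (c * s l 0 i) = c * dot (s k) (s l).
  by rewrite mulr_sumr; apply: eq_bigr => i _; ring.
have -> : \sum_i (\matrix_(i < d.+1, k < #|S|) s k 0 i)^T k i *
    (\matrix_(i, l) (- 4%:R * Q (s l) * s l 0 i)) i l =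
    - 4%:R * Q (s l) * dot (s k) (s l).
  by rewrite -dotZ; apply: eq_bigr => i _; rewrite !mxE.
have -> : \sum_i (\matrix_(k, i) ((- 4%:R * Q (s k) + 2%:R * (a + b)) *
      s k 0 i)) k i * (\matrix_(i < d.+1, l < #|S|) s l 0 i) i l =
    (- 4%:R * Q (s k) + 2%:R * (a + b)) * dot (s k) (s l).
  by rewrite -dotZ; apply: eq_bigr => i _; rewrite !mxE -/(s l); ring.
rewrite WE Q_sub; ring.
Qed.

Lemma sq_distance_mem d (S : {set 'rV[F]_d}) x y :
  x \in S -> y \in S -> x != y -> Q (x - y) \in sq_distances S.
Proof. by move=> xS yS xy; apply/imset2P; exists x y; rewrite ?inE ?yS. Qed.

Lemma two_distance_bound d (S : {set 'rV[F]_d.+1}) :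
  two_distance_set S -> 0 \notin sq_distances S ->
  (#|S| + \rank (affine_mx S *m (affine_hat_mx S)^T) <=
   'C(d.+3, 2) - 1 + \rank (affine_hat_mx S))%N.
Proof.
rewrite /two_distance_set => /eqP/cards2P[a [b [_ SD]]] nz.
have [U [V eqM]] := affine_decomposition S a b.
have ab0 : a * b != 0.
  by move: nz; rewrite SD !inE negb_or mulf_eq0 negb_or ![0 == _]eq_sym.
have {}eqM : (a * b)%:M = (affine_mx S)^T *m U + V *m affine_hat_mx S +
    4%:R *: quad_mx (fun k : 'I_#|S| => enum_val k).
  rewrite -eqM; apply/matrixP => k l; rewrite !mxE.
  have [->|kl] := eqVneq k l.
    by rewrite subrr /Q big1 ?mulr1n; [ring | move=> i _; rewrite mxE expr0n].
  have : Q (enum_val k - enum_val l) \in sq_distances S.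
    by apply: sq_distance_mem; rewrite ?enum_valP // (inj_eq enum_val_inj).
  by rewrite SD mulr0n !inE => /orP[]/eqP->; rewrite subrr ?mulr0 ?mul0r.
set A := affine_mx S in eqM *; set B := affine_hat_mx S in eqM *.
set W := quad_mx _ in eqM.
have rkW : (\rank (kermx B^T *m (kermx A^T)^T) <= d + 'C(d.+1, 2))%N.
  rewrite -mxrank_tr trmx_mul trmxK -(mxrank_scale_nz _ ab0).
  have BK0 : B *m (kermx B^T)^T = 0.
    by apply: trmx_inj; rewrite trmx_mul trmxK mulmx_ker trmx0.
  rewrite scalemxAl -mul_mx_scalar eqM !mulmxDr !mulmxDl !mulmxA mulmx_ker.
  rewrite !mul0mx add0r -[_ *m B *m _]mulmxA BK0 mulmx0 add0r.
  rewrite -scalemxAr -scalemxAl.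
  apply: leq_trans (mxrank_scale _ _) _.
  apply: leq_trans (mxrankM_maxl _ _) _.
  by apply: leq_trans (mxrankM_maxr _ _) _; apply: rank_quad_mx.
(* The pairing has rank at most ['C(d.+2, 2) - 1] and [A] at most [d.+2]; by Pascal's rule these add
   up to ['C(d.+3, 2) - 1]. *)
have := rank_ker_pairing A B; have := rank_leq_row A.
have := binS d.+2 1; have := binS d.+1 1.
rewrite !bin1 => e1 e2 rA <-; rewrite e2 e1.
move: rkW; set k := \rank (_ *m _).
move: k (\rank A) rA (\rank B) => k rA hA rB.
lia.
Qed.

End Bound.

(** * Affine coordinates of point families, and midpoints *)

Section Families.
Variables (F : finFieldType) (d : nat).
Implicit Types x y z : 'rV[F]_d.

(** Indexing by a family covers both the vertices [P] and, through [enum_val], the matrix of a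
    set. *)
Definition family_mx n (s : 'I_n -> 'rV[F]_d) : 'M[F]_(1 + d, n) :=
  col_mx (const_mx 1) (\matrix_(i < d, k < n) s k 0 i).

Definition family_hat_mx n (s : 'I_n -> 'rV[F]_d) : 'M[F]_(1 + d + 1, n) :=
  col_mx (family_mx s) (\row_(k < n) Q (s k)).

(* Column [j] lists the coefficients of [Q (x - s j)] on the rows of
   [family_hat_mx]. *)
Definition sphere_mx n (s : 'I_n -> 'rV[F]_d) : 'M[F]_(1 + d + 1, n) :=
  col_mx (col_mx (\row_j Q (s j)) (\matrix_(i, j) (- 2%:R * s j 0 i)))
         (const_mx 1).

Lemma family_hat_sphere m n (s : 'I_m -> 'rV[F]_d) (t : 'I_n -> 'rV[F]_d) :
  (family_hat_mx s)^T *m sphere_mx t = \matrix_(k, j) Q (s k - t j).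
Proof.
rewrite !tr_col_mx !mul_row_col; apply/matrixP => k j.
rewrite !mxE !big_ord1 !mxE Q_sub.
have -> : \sum_i (\matrix_(i < d, k < m) s k 0 i)^T k i *
    (\matrix_(i, j) (- 2%:R * t j 0 i)) i j = - (dot (s k) (t j) *+ 2).
  rewrite -sumrMnl -sumrN.
  by apply: eq_bigr => i _; rewrite !mxE; ring.
by ring.
Qed.

Definition homog x : 'rV[F]_(1 + d) := row_mx 1 x.

Lemma family_mxE n (s : 'I_n -> 'rV[F]_d) r k :
  family_mx s r k = homog (s k) 0 r.
Proof.
rewrite /family_mx /homog -[r]splitK; case: (split r) => i /=.
  by rewrite col_mxEu row_mxEl !mxE ord1.
by rewrite col_mxEd row_mxEr !mxE.
Qed.

Lemma Q_opp x : Q (- x) = Q x.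
Proof. by apply: eq_bigr => i _; rewrite mxE sqrrN. Qed.

Lemma Q_subC x y : Q (x - y) = Q (y - x).
Proof. by rewrite -Q_opp opprB. Qed.

Hypothesis two_neq0 : 2%:R != 0 :> F.

Lemma four_neq0 : 4%:R != 0 :> F.
Proof. by rewrite (natrM _ 2 2) mulf_neq0. Qed.

Definition mid x y := 2%:R^-1 *: (x + y).

Lemma midC x y : mid x y = mid y x.
Proof. by rewrite /mid addrC. Qed.

Lemma hom_mid x y r :
  homog (mid x y) 0 r = (homog x 0 r + homog y 0 r) / 2%:R.
Proof.
rewrite /homog -[r]splitK; case: (split r) => i /=.
  by rewrite !row_mxEl !mxE; case: (_ == _); field.
by rewrite !row_mxEr !mxE mulrC.
Qed.

(** Apollonius's median formula, valid coordinate by coordinate. *)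
Lemma Q_mid_sub x y z :
  Q (mid x y - z) =
  (Q (x - z) + Q (y - z)) / 2%:R - Q (x - y) / 4%:R.
Proof.
rewrite /Q -big_split !mulr_suml -sumrB; apply: eq_bigr => i _ /=.
by rewrite !mxE; field; rewrite two_neq0 four_neq0.
Qed.

End Families.

(** * Midpoints of [d + 2] equilateral points *)

Section Equilateral.
Variables (F : finFieldType) (d : nat) (P : 'I_(d + 2) -> 'rV[F]_d).
Variable Delta : F.
Hypothesis Delta_neq0 : Delta != 0.
Hypothesis two_neq0 : 2%:R != 0 :> F.
Hypothesis card0 : (d + 2)%:R = 0 :> F.
Hypothesis equilateral :
  forall i j : 'I_(d + 2), i != j -> Q (P i - P j) = Delta.

Lemma Q_vertices i j : Q (P i - P j) = Delta * (i != j)%:R.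
Proof.
case: eqVneq => [->|/equilateral->]; last by rewrite mulr1.
by rewrite subrr mulr0 /Q big1 // => k _; rewrite mxE expr0n.
Qed.

Lemma Q_mid_vertex a b j : a != b ->
  Q (mid (P a) (P b) - P j) =
  Delta * ((a != j)%:R + (b != j)%:R) / 2%:R - Delta / 4%:R.
Proof.
move=> ab; rewrite Q_mid_sub // (equilateral ab) !Q_vertices.
by field; rewrite two_neq0 (four_neq0 two_neq0).
Qed.

Lemma Q_mid_mid a b k l : a != b -> k != l ->
  Q (mid (P a) (P b) - mid (P k) (P l)) =
  Delta * ((a != k)%:R + (a != l)%:R + (b != k)%:R + (b != l)%:R) / 4%:R -
  Delta / 2%:R.
Proof.
move=> ab kl; rewrite Q_mid_sub // ![Q (_ - mid _ _)]Q_subC !Q_mid_vertex //.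
rewrite (equilateral ab) [k == a]eq_sym [l == a]eq_sym [k == b]eq_sym.
by rewrite [l == b]eq_sym; field; rewrite two_neq0 (four_neq0 two_neq0).
Qed.

(** A dependency [c] kills the affine rows, so only the row of [Q] survives and [c] times the
    distance matrix is a constant row. That matrix is [Delta] times all-ones minus identity, which
    forces the entries of [c] to agree. *)
Lemma ker_vertices (c : 'rV[F]_(d + 2)) :
  c *m (family_mx P)^T = 0 -> exists w, c = const_mx w.
Proof.
move=> c0; have := mulmxA c (family_hat_mx P)^T (sphere_mx P).
rewrite family_hat_sphere /family_hat_mx tr_col_mx mul_mx_row c0 mul_row_col.
rewrite mul0mx add0r; set g := c *m (\row__ _)^T => /rowP eq_e.
exists (\sum_i c 0 i - g 0 0 / Delta); apply/rowP => j.
have := eq_e j; rewrite mxE [RHS]mxE big_ord1 [const_mx _ _ _]mxE mulr1 mxE.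
have -> : \sum_i c 0 i * (\matrix_(k, j) Q (P k - P j)) i j =
    Delta * (\sum_i c 0 i - c 0 j).
  rewrite (bigD1 j) //= [in RHS](bigD1 j) //= addrAC subrr add0r mulr_sumr.
  rewrite !mxE Q_vertices eqxx !mulr0 add0r.
  by apply: eq_bigr => i ij; rewrite mxE equilateral // mulrC.
by move=> <-; rewrite [RHS]mxE; field.
Qed.

(** There are [d + 2] columns and [d + 1] rows, so dependencies exist; by [ker_vertices] they lie on
    the line of constant rows, hence fill it. *)
Lemma vertices_rank_kernel :
  \rank (family_mx P) = d.+1 /\ (const_mx 1 : 'rV[F]__) *m (family_mx P)^T = 0.
Proof.
set B := family_mx P; pose o : 'rV[F]_(d + 2) := const_mx 1.
have kero : (kermx B^T <= o)%MS.
  apply/row_subP => i; apply/sub_rVP.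
  have [w ->] : exists w, row i (kermx B^T) = const_mx w.
    apply: ker_vertices; apply/sub_kermxP; exact: row_sub.
  by exists w; apply/rowP => j; rewrite !mxE mulr1.
have := mxrankS kero; have := rank_leq_row o; have := rank_leq_row B.
rewrite mxrank_ker mxrank_tr => rB ro rk.
have eB : \rank B = d.+1 by lia.
split=> //; apply/sub_kermxP.
by rewrite -(mxrank_leqif_sup kero) mxrank_ker mxrank_tr eB eqn_leq; lia.
Qed.

Lemma sum_hom_vertices r : \sum_a homog (P a) 0 r = 0.
Proof.
have [_ /rowP/(_ r)] := vertices_rank_kernel.
rewrite mxE [RHS]mxE => e; rewrite -[RHS]e.
apply: eq_bigr => a _.
by rewrite [const_mx _ _ _]mxE mul1r [_^T _ _]mxE family_mxE.
Qed.

Definition ord_pairs : {set 'I_(d + 2) * 'I_(d + 2)} :=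
  [set p : 'I_(d + 2) * 'I_(d + 2) | (p.1 < p.2)%N].

Definition midp (p : 'I_(d + 2) * 'I_(d + 2)) := mid (P p.1) (P p.2).

Lemma midpointsE : midpoints P = [set midp p | p in ord_pairs].
Proof.
apply/setP => x; apply/imset2P/imsetP => [[i j _ /[!inE] ij ->]|[[i j] ij ->]].
  by exists (i, j); rewrite ?inE.
by rewrite inE in ij; exists i j; rewrite ?inE.
Qed.

Lemma Q_midp_sub p p' : p \in ord_pairs -> p' \in ord_pairs -> p != p' ->
  Q (midp p - midp p') \in [set Delta / 4%:R; Delta / 2%:R].
Proof.
case: p p' => [a b] [k l]; rewrite !inE /= => ab kl.
rewrite xpair_eqE negb_and => pp'.
have ab' : a != b by rewrite -val_eqE ltn_eqF.
have kl' : k != l by rewrite -val_eqE ltn_eqF.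
rewrite /midp Q_mid_mid //=.
(* Distinct increasing pairs share one index or none. Three inequalities give [Delta / 4], four give
   [Delta / 2]. *)
have : (((a != k) + (a != l) + (b != k) + (b != l)) \in [:: 3; 4])%N.
  by move: pp' ab kl; rewrite -!val_eqE !inE /=; do !case: eqP => ? //=; lia.
rewrite -!natrD !inE => /orP[]/eqP->; [apply/orP; left|apply/orP; right].
  by apply/eqP; field; rewrite two_neq0 (four_neq0 two_neq0).
by apply/eqP; field; rewrite two_neq0 (four_neq0 two_neq0).
Qed.

Lemma quarter_half_neq0 : 0 \notin [set Delta / 4%:R; Delta / 2%:R].
Proof.
rewrite !inE ![0 == _]eq_sym !mulf_eq0 !invr_eq0 (negPf Delta_neq0).
by rewrite (negPf two_neq0) (negPf (four_neq0 two_neq0)).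
Qed.

(** Midpoints of distinct pairs are at nonzero squared distance. *)
Lemma midp_inj : {in ord_pairs &, injective midp}.
Proof.
move=> p p' pT p'T eqm; apply/eqP; apply: contraT => /(Q_midp_sub pT p'T).
rewrite eqm subrr /Q big1 => [|i _]; last by rewrite mxE expr0n.
by rewrite (negPf quarter_half_neq0).
Qed.

Lemma sum_midpoints (V : nmodType) (f : 'rV[F]_d -> V) :
  \sum_(x in midpoints P) f x =
  \sum_(i < d + 2) \sum_(j < d + 2 | (j < i)%N) f (mid (P i) (P j)).
Proof.
rewrite midpointsE big_imset /=; last exact: midp_inj.
rewrite (exchange_big_dep xpredT) //= pair_big_dep /=.
by apply: eq_big => [p|p _]; rewrite ?inE // midC.
Qed.

Lemma card_midpoints : #|midpoints P| = 'C(d + 2, 2).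
Proof.
rewrite -sum1_card sum_midpoints -bin2_sum big_mkord.
by apply: eq_bigr => i _; rewrite card_ord_lt.
Qed.

Lemma sq_distances_midpoints : (2 <= d)%N ->
  sq_distances (midpoints P) = [set Delta / 4%:R; Delta / 2%:R].
Proof.
move=> hd; apply/setP => c; apply/idP/idP.
  rewrite midpointsE => /imset2P[x y xX /[1!inE] /andP[yX xy] ->].
  move: xX yX xy => /imsetP[p pT ->] /imsetP[p' p'T ->] xy.
  by apply: Q_midp_sub => //; apply: contraNneq xy => ->.
(* As [2 <= d] there are four vertices: the pairs 01 and 02 realize [Delta / 4], the disjoint pairs
   01 and 23 realize [Delta / 2]. *)
have [h0 h1 h2 h3] : [/\ 0 < d + 2, 1 < d + 2, 2 < d + 2 & 3 < d + 2]%N.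
  by split; lia.
pose v0 := Ordinal h0; pose v1 := Ordinal h1.
pose v2 := Ordinal h2; pose v3 := Ordinal h3.
have memX (i j : 'I_(d + 2)) : (i < j)%N -> mid (P i) (P j) \in midpoints P.
  by move=> ij; rewrite midpointsE; apply/imsetP; exists (i, j); rewrite ?inE.
have dist (i j k l : 'I_(d + 2)) : (i < j)%N -> (k < l)%N -> (i, j) != (k, l) ->
    Q (mid (P i) (P j) - mid (P k) (P l)) \in sq_distances (midpoints P).
  move=> ij kl ne; apply: sq_distance_mem; rewrite ?memX //.
  by apply: contra_neq ne => e; apply: midp_inj; rewrite ?inE.
rewrite in_set2 => /orP[]/eqP->.
  have -> : Delta / 4%:R = Q (mid (P v0) (P v1) - mid (P v0) (P v2)).
    by rewrite Q_mid_mid //=; field; rewrite two_neq0 (four_neq0 two_neq0).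
  exact: dist.
have -> : Delta / 2%:R = Q (mid (P v0) (P v1) - mid (P v2) (P v3)).
  by rewrite Q_mid_mid //=; field; rewrite two_neq0 (four_neq0 two_neq0).
exact: dist.
Qed.

(** Multiplying by [sphere_mx P] turns the product into the sums of [homog x 0 r * Q (x - P j)] over
    the midpoints [x]. *)
Lemma family_mx_sphere :
  let X := midpoints P in
  affine_mx X *m (affine_hat_mx X)^T *m sphere_mx P =
  (Delta / 2%:R) *: family_mx P.
Proof.
move=> X; rewrite -mulmxA.
rewrite [_ *m sphere_mx P](family_hat_sphere (fun k : 'I_#|X| => enum_val k)).
apply/matrixP => r j; rewrite mxE [RHS]mxE family_mxE.
pose g x := homog x 0 r * Q (x - P j).
rewrite (eq_bigr (fun k => g (enum_val k))) => [|k _]; last first.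
  rewrite [(\matrix_(_, _) _) _ _]mxE; congr (_ * _).
  exact: (family_mxE (fun k : 'I_#|X| => enum_val k)).
rewrite -(big_enum_val g) sum_midpoints.
pose h a : F := homog (P a) 0 r.
(* Halving [g] between the two endpoints turns the sum over unordered pairs into one over ordered
   pairs. *)
pose f a b := h a / 2%:R * Q (mid (P a) (P b) - P j).
have gE a b : g (mid (P a) (P b)) = f a b + f b a.
  by rewrite /g /f /h hom_mid // [mid (P b) _]midC; field.
under eq_bigr => a _ do under eq_bigr => b _ do rewrite gE.
rewrite -sum_offdiag.
have sum_neq (c : 'I_(d + 2)) : \sum_(b < d + 2 | b != c) 1 = -1 :> F.
  have := sumr_const 'I_(d + 2) (1 : F); rewrite card_ord card0 (bigD1 c) //=.
  by move=> /eqP; rewrite addrC addr_eq0 => /eqP.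
have sum_neq2 (a c : 'I_(d + 2)) :
    \sum_(b < d + 2 | b != a) (b != c)%:R = -1 - (a != c)%:R :> F.
  apply/eqP; rewrite -subr_eq opprK; apply/eqP.
  transitivity (\sum_(b < d + 2) (b != c)%:R : F).
    by rewrite [RHS](bigD1 a) //= addrC.
  rewrite (bigD1 c) //= eqxx add0r -[RHS](sum_neq c).
  by apply: eq_bigr => b ->.
have four := four_neq0 two_neq0.
have eight_neq0 : 8%:R != 0 :> F by rewrite (natrM _ 2 4) mulf_neq0.
(* Both sums over [b] are evaluated with [d + 1 = -1] in [F]. The coefficient [5/8] does not depend
   on [a], so its term disappears by [sum_hom_vertices]. *)
have inner a : \sum_(b | b != a) f a b =
    Delta / 2%:R * ((a == j)%:R * h a) - Delta * 5%:R / 8%:R * h a.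
  rewrite -mulr_sumr.
  transitivity (h a / 2%:R * \sum_(b | b != a)
     ((Delta * (a != j)%:R / 2%:R - Delta / 4%:R) * 1 +
      Delta / 2%:R * (b != j)%:R)).
    congr (_ * _); apply: eq_bigr => b ba.
    by rewrite Q_mid_vertex 1?eq_sym //; field; rewrite two_neq0 four.
  rewrite big_split -!mulr_sumr sum_neq sum_neq2 /=.
  by case: (a == j); rewrite /= ?mulr1n ?mulr0n; field;
     rewrite eight_neq0 two_neq0 four.
under eq_bigr => a _ do rewrite inner.
rewrite sumrB -!mulr_sumr sum_hom_vertices mulr0 subr0 (bigD1 j) //= big1.
  by rewrite eqxx mul1r addr0.
by move=> a /negPf->; rewrite mul0r.
Qed.

(** There are only [d.+1] rows, and a further product with [sphere_mx P] still has the full rank of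
    [family_mx P]. *)
Lemma midpoints_rank_mul :
  let X := midpoints P in
  \rank (affine_mx X *m (affine_hat_mx X)^T) = d.+1.
Proof.
move=> X; apply/eqP; rewrite eqn_leq; apply/andP; split.
  exact: rank_leq_row.
have [rP _] := vertices_rank_kernel; rewrite -rP.
have D2 : Delta / 2%:R != 0 by rewrite mulf_neq0 ?invr_neq0.
by rewrite -(mxrank_scale_nz _ D2) -family_mx_sphere mxrankM_maxl.
Qed.

End Equilateral.

Theorem proposition4p7 (q p d : nat) (F : finFieldType)
    (hq : #|F| = q) (q_odd : odd q) (hp : p \in [pchar F])
    (hd : (2 <= d)%N) (hpd : (p %| d + 2)%N)
    (P : 'I_(d + 2) -> 'rV[F]_d) (Delta : F) (Delta_neq0 : Delta != 0)
    (equilateral : forall i j : 'I_(d + 2), i != j -> Q (P i - P j) = Delta) :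
  let X := midpoints P in
  [/\ two_distance_set X,
      #|X| = 'C(d + 2, 2) &
      sq_distances X = [set Delta / 4%:R; Delta / 2%:R]] /\
  (\rank (affine_hat_mx X)
    - \rank (affine_mx X *m (affine_hat_mx X)^T) = 1)%N /\
  (forall S : {set 'rV[F]_d},
     two_distance_set S -> 0 \notin sq_distances S ->
     (#|S| <= 'C(d + 2, 2) - 1 + \rank (affine_hat_mx S)
       - \rank (affine_mx S *m (affine_hat_mx S)^T))%N) /\
  0 \notin sq_distances X /\
  ('C(d + 2, 2) - 1 + \rank (affine_hat_mx X)
    - \rank (affine_mx X *m (affine_hat_mx X)^T))%N = 'C(d + 2, 2) /\
  (#|X| <= 'C(d + 2, 2))%N.
Proof.
have card0 : (d + 2)%:R = 0 :> F by apply/eqP; rewrite -(dvdn_pcharf hp).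
have two_neq0 : 2%:R != 0 :> F.
  (* Lagrange in the additive group; if 2 vanished, the odd number [q] would be 1 in [F]. *)
  have cardF0 : #|F|%:R = 0 :> F.
    have := @expg_cardG _ [set: F]%G (1%R : F) (in_setT _).
    by rewrite cardsT FinRing.zmodXgE.
  apply: contraPneq cardF0 => two0; apply/eqP.
  rewrite hq -[q]odd_double_half q_odd natrD -mul2n natrM two0 mul0r addr0.
  exact: oner_neq0.
move=> X.
have bound (S : {set 'rV[F]_d}) :
  two_distance_set S -> 0 \notin sq_distances S ->
  (#|S| + \rank (affine_mx S *m (affine_hat_mx S)^T) <=
   'C(d + 2, 2) - 1 + \rank (affine_hat_mx S))%N.
  move: S; clear -hd; case: d hd => [//|d'] _ S; rewrite addn2.
  exact: two_distance_bound.
have dX := sq_distances_midpoints Delta_neq0 two_neq0 equilateral hd.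
have cX := card_midpoints Delta_neq0 two_neq0 equilateral.
have nz : 0 \notin sq_distances X.
  by rewrite dX quarter_half_neq0.
have tX : two_distance_set X.
  rewrite /two_distance_set dX cards2.
  suff -> : Delta / 4%:R != Delta / 2%:R by [].
  rewrite -subr_eq0.
  have -> : Delta / 4%:R - Delta / 2%:R = - Delta / 4%:R.
    by field; rewrite two_neq0 four_neq0.
  by rewrite mulf_neq0 ?oppr_eq0 ?invr_neq0 ?four_neq0.
have rX := midpoints_rank_mul Delta_neq0 two_neq0 card0 equilateral.
have bX := bound X tX nz; have rhX := rank_leq_row (affine_hat_mx X).
(* Positivity makes the truncated [- 1] exact. The bound for [X] then gives a rank gap of at least
   1, and the [d + 2] rows of [affine_hat_mx X] give at most 1. *)
have bin_gt0 : (0 < 'C(d + 2, 2))%N by rewrite bin_gt0; lia.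
have gap : (\rank (affine_hat_mx X)
    - \rank (affine_mx X *m (affine_hat_mx X)^T) = 1)%N.
  move: bX rX rhX cX; rewrite /= -/X.
  move: #|X| (\rank (affine_hat_mx X)) (\rank (_ *m _)) => k m n; lia.
split; first by split.
split=> //; split.
  move=> S tS nzS; have := bound S tS nzS.
  by move: #|S| (\rank (affine_hat_mx S)) (\rank (_ *m _)) => k m n; lia.
split=> //; split; last by rewrite cX.
move: gap bin_gt0.
move: (\rank (affine_hat_mx X)) (\rank (_ *m _)) 'C(_, _) => m n k; lia.
Qed.
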